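(* Let $k$ be a field of characteristic $p\ge 0$ and let $A=kQ/I$ be a finite-dimensional algebra. For every loop $a\in Q_1$, let $n_a$ denote the minimal integer such that $a^{n_a}\in\mathrm{rad}(A)^{n_a+1}$. If $p\nmid\prod_a n_a$ (product over all loops $a\in Q_1$), then $$\mathrm{Der}_{\mathrm{rad}}(A)=\mathrm{Der}(A)\quad\text{and}\quad \mathrm{HH}^1_{\mathrm{rad}}(A)=\mathrm{HH}^1(A).$$
   Context: Writing $A=kQ/I$ means that $Q$ is a finite quiver with arrow set $Q_1$ and $I$ is an admissible ideal of $kQ$; arrows are identified with their images in $A$, and $n_a$ is taken among positive integers. If $p=0$ the condition $p\nmid\prod_a n_a$ holds automatically, and the empty product is $1$. $\mathrm{Der}(A)$ is the Lie algebra of $k$-linear derivations of $A$; $\mathrm{Der}_{\mathrm{rad}}(A)=\{\delta\in\mathrm{Der}(A):\delta(\mathrm{rad}(A))\subseteq\mathrm{rad}(A)\}$, where $\mathrm{rad}(A)$ is the Jacobson radical; $\mathrm{Inn}(A)=\{[a,-]:a\in A\}\subseteq \mathrm{Der}_{\mathrm{rad}}(A)$; $\mathrm{HH}^1(A)=\mathrm{Der}(A)/\mathrm{Inn}(A)$ and $\mathrm{HH}^1_{\mathrm{rad}}(A)=\mathrm{Der}_{\mathrm{rad}}(A)/\mathrm{Inn}(A)\subseteq\mathrm{HH}^1(A)$. *)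

(* Defs.v *)
From HB Require Import structures.
From mathcomp Require Import all_boot all_order all_algebra all_field.
From mathcomp Require Import finmap boolp classical_sets.
From mathcomp.multinomials Require Import monalg.

Set Implicit Arguments.
Unset Strict Implicit.
Unset Printing Implicit Defensive.

Import GRing.Theory.
Local Open Scope classical_set_scope.
Local Open Scope ring_scope.

Record quiver := Quiver {
  vertex : finType;
  arrow : finType;
  source : arrow -> vertex;
  target : arrow -> vertex }.

Definition is_loop (Q : quiver) (a : arrow Q) : bool := source a == target a.

(* A path is a starting vertex together with a sequence of arrows read from
   left to right; the trivial path at i is (i, [::]). *)
Fixpoint is_walk (Q : quiver) (i : vertex Q) (s : seq (arrow Q)) : bool :=
  if s is a :: s' then (source a == i) && is_walk (target a) s' else true.

Record qpath (Q : quiver) := QPath {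
  qpath_val : vertex Q * seq (arrow Q);
  qpathP : is_walk qpath_val.1 qpath_val.2 }.

HB.instance Definition _ (Q : quiver) := [isSub for @qpath_val Q].
HB.instance Definition _ (Q : quiver) := [Choice of qpath Q by <:].

Section Paths.
Context {Q : quiver}.
Implicit Types (p q r : qpath Q) (i : vertex Q) (s t : seq (arrow Q)).

Definition pstart p : vertex Q := (qpath_val p).1.
Definition parrows p : seq (arrow Q) := (qpath_val p).2.
Definition pend p : vertex Q := last (pstart p) (map (@target Q) (parrows p)).

Definition trivial_path i : qpath Q := @QPath Q (i, [::]) isT.

Fact arrow_path_subproof (a : arrow Q) : is_walk (source a) [:: a].
Proof. by rewrite /= eqxx. Qed.
Definition arrow_path (a : arrow Q) : qpath Q :=
  @QPath Q (source a, [:: a]) (arrow_path_subproof a).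

Lemma is_walk_cat i s t :
  is_walk i (s ++ t) = is_walk i s && is_walk (last i (map (@target Q) s)) t.
Proof. by elim: s i => //= a s IHs i; rewrite IHs andbA. Qed.

(* When pend p == pstart q the insertion always succeeds. The test cannot be
   left to insub, because a trivial path q leaves no trace in the
   concatenation. *)
Definition pcat p q : option (qpath Q) :=
  if pend p == pstart q then insub (pstart p, parrows p ++ parrows q) else None.

Lemma pcat_some p q : pend p = pstart q ->
  exists r, [/\ pcat p q = Some r, pstart r = pstart p, pend r = pend q
              & parrows r = parrows p ++ parrows q].
Proof.
move=> pq; have w : is_walk (pstart p) (parrows p ++ parrows q).
  by rewrite is_walk_cat (qpathP p) -/(pend p) pq (qpathP q).
exists (@QPath Q (pstart p, parrows p ++ parrows q) w); split=> //.
  by rewrite /pcat pq eqxx insubT.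
by rewrite /pend /= map_cat last_cat -/(pend p) pq.
Qed.

Lemma pcat_none p q : pend p != pstart q -> pcat p q = None.
Proof. by rewrite /pcat => /negbTE->. Qed.

Lemma qpath_eq p q : pstart p = pstart q -> parrows p = parrows q -> p = q.
Proof.
by move=> s_pq a_pq; apply: val_inj; apply: injective_projections.
Qed.

Lemma pcatA p q r :
  obind (fun x => pcat x r) (pcat p q) = obind (pcat p) (pcat q r).
Proof.
have [pq|pq] := eqVneq (pend p) (pstart q); last first.
  rewrite pcat_none //=; have [qr|qr] := eqVneq (pend q) (pstart r).
    have [y [-> sy _ _]] := pcat_some qr.
    by rewrite /= pcat_none // sy.
  by rewrite pcat_none.
have [x [-> sx ex ax]] := pcat_some pq.
have [qr|qr] := eqVneq (pend q) (pstart r); last first.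
  by rewrite (pcat_none qr) /= pcat_none // ex.
have [y [-> sy ey ay]] := pcat_some qr; rewrite /=.
have [|z [-> sz _ az]] := @pcat_some x r; first by rewrite ex.
have [|w [-> sw _ aw]] := @pcat_some p y; first by rewrite sy.
by congr Some; apply: qpath_eq; rewrite ?sz ?sw // az aw ax ay catA.
Qed.

Lemma pcat_trivl i q : pcat (trivial_path i) q = if i == pstart q then Some q else None.
Proof.
have [iq|iq] := eqVneq i (pstart q); last by rewrite pcat_none.
have [|r [-> sr _ ar]] := @pcat_some (trivial_path i) q; first by [].
by congr Some; apply: qpath_eq; rewrite ?sr.
Qed.

Lemma pcat_trivr i p : pcat p (trivial_path i) = if pend p == i then Some p else None.
Proof.
have [iq|iq] := eqVneq (pend p) i; last by rewrite pcat_none.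
have [|r [-> sr _ ar]] := @pcat_some p (trivial_path i); first by [].
by congr Some; apply: qpath_eq; rewrite ?sr // ar cats0.
Qed.

End Paths.

(* The algebra structure of MathComp excludes the zero ring, hence the path
   algebra of the empty quiver, so kQ only gets the structures of a ring and
   of a left k-module; compatibility is pa_scalerAl and pa_scalerAr below. *)
Definition path_algebra (k : fieldType) (Q : quiver) : Type :=
  {malg k[qpath Q]}.

HB.instance Definition _ (k : fieldType) (Q : quiver) :=
  GRing.Lmodule.copy (path_algebra k Q) {malg k[qpath Q]}.

HB.lock Definition of_path {k : fieldType} {Q : quiver} (p : qpath Q) :
  path_algebra k Q := << p >>.

Definition path_mul {k : fieldType} {Q : quiver} (p q : qpath Q) :
  path_algebra k Q := oapp of_path 0 (pcat p q).

HB.lock Definition pa_mul {k : fieldType} {Q : quiver}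
    (f g : path_algebra k Q) : path_algebra k Q :=
  \sum_(p <- msupp f) \sum_(q <- msupp g) (f@_p * g@_q) *: path_mul p q.

HB.lock Definition pa_one {k : fieldType} {Q : quiver} : path_algebra k Q :=
  \sum_(i : vertex Q) of_path (trivial_path i).

Section PathAlgebra.
Context {k : fieldType} {Q : quiver}.
Local Notation kQ := (path_algebra k Q).
Implicit Types (f g h : kQ) (p q r : qpath Q).

Lemma pa_mulw (df dg : {fset qpath Q}) f g :
  (msupp f `<=` df)%fset -> (msupp g `<=` dg)%fset ->
  pa_mul f g =
  \sum_(p <- df) \sum_(q <- dg) (f@_p * g@_q) *: path_mul p q.
Proof.
move=> sf sg; rewrite pa_mul.unlock (big_fset_incl _ sf) /=; last first.
  move=> p _ /mcoeff_outdom fp; rewrite big1 // => q _.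
  by rewrite fp mul0r scale0r.
apply: eq_bigr => p _; rewrite (big_fset_incl _ sg) //= => q _ /mcoeff_outdom gq.
by rewrite gq mulr0 scale0r.
Qed.

Lemma pa_mulDl : left_distributive (@pa_mul k Q) +%R.
Proof.
move=> f g h.
have sf : (msupp f `<=` msupp f `|` msupp g)%fset by apply: fsubsetUl.
have sg : (msupp g `<=` msupp f `|` msupp g)%fset by apply: fsubsetUr.
have sfg : (msupp (f + g) `<=` msupp f `|` msupp g)%fset by apply: msuppD_le.
have sh := fsubset_refl (msupp h).
rewrite (pa_mulw sf sh) (pa_mulw sg sh) (pa_mulw sfg sh) -big_split.
apply: eq_bigr => p _; rewrite -big_split; apply: eq_bigr => q _ /=.
by rewrite mcoeffD mulrDl scalerDl.
Qed.

Lemma pa_mulDr : right_distributive (@pa_mul k Q) +%R.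
Proof.
move=> h f g.
have sf : (msupp f `<=` msupp f `|` msupp g)%fset by apply: fsubsetUl.
have sg : (msupp g `<=` msupp f `|` msupp g)%fset by apply: fsubsetUr.
have sfg : (msupp (f + g) `<=` msupp f `|` msupp g)%fset by apply: msuppD_le.
have sh := fsubset_refl (msupp h).
rewrite (pa_mulw sh sf) (pa_mulw sh sg) (pa_mulw sh sfg) -big_split.
apply: eq_bigr => p _; rewrite -big_split; apply: eq_bigr => q _ /=.
by rewrite mcoeffD mulrDr scalerDl.
Qed.

Lemma pa_scalerAl (c : k) f g : c *: pa_mul f g = pa_mul (c *: f) g.
Proof.
have sf : (msupp (c *: f) `<=` msupp f)%fset by apply: msuppZ_le.
rewrite (pa_mulw sf (fsubset_refl _)) pa_mul.unlock scaler_sumr; apply: eq_bigr => p _.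
rewrite scaler_sumr; apply: eq_bigr => q _.
by rewrite scalerA mcoeffZ mulrA.
Qed.

Lemma pa_scalerAr (c : k) f g : c *: pa_mul f g = pa_mul f (c *: g).
Proof.
have sg : (msupp (c *: g) `<=` msupp g)%fset by apply: msuppZ_le.
rewrite (pa_mulw (fsubset_refl _) sg) pa_mul.unlock scaler_sumr; apply: eq_bigr => p _.
rewrite scaler_sumr; apply: eq_bigr => q _.
by rewrite scalerA mcoeffZ mulrCA.
Qed.

Lemma pa_mul_path p q : pa_mul (of_path p) (of_path q) = path_mul p q :> kQ.
Proof.
rewrite of_path.unlock (pa_mulw (@msuppU_le _ _ p 1) (@msuppU_le _ _ q 1)).
by rewrite !big_seq_fset1 !mcoeffUU mulr1 scale1r.
Qed.

Lemma pa_mul0l g : pa_mul 0 g = 0.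
Proof. by rewrite pa_mul.unlock msupp0 big_seq_fset0. Qed.

Lemma pa_mul0r f : pa_mul f 0 = 0.
Proof. by rewrite pa_mul.unlock big1 // => p _; rewrite msupp0 big_seq_fset0. Qed.

Lemma pa_ind (P : kQ -> Prop) :
  P 0 -> (forall c p, P (c *: of_path p)) ->
  (forall f g, P f -> P g -> P (f + g)) -> forall f, P f.
Proof.
move=> P0 Pp PD f; rewrite [f]monalgE; apply: big_ind => // p _.
suff -> : << f@_p *g p >> = f@_p *: of_path p by [].
apply/malgP => q; rewrite of_path.unlock [RHS]mcoeffZ [LHS]mcoeffU.
by rewrite [in RHS]mcoeffU mulrnAr mulr1.
Qed.

Lemma pa_mulA : associative (@pa_mul k Q).
Proof.
move=> f g h; elim/pa_ind: f => [|c p|f f' Hf Hf']; first by rewrite !pa_mul0l.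
  rewrite -!pa_scalerAl; congr (_ *: _).
  elim/pa_ind: g => [|d q|g g' Hg Hg']; first by rewrite !(pa_mul0l, pa_mul0r).
    rewrite -(pa_scalerAl d (of_path q)) -(pa_scalerAr d (of_path p)).
    rewrite -(pa_scalerAr d (of_path p) (of_path q)) -(pa_scalerAl d).
    congr (_ *: _).
    elim/pa_ind: h => [|e r|h h' Hh Hh']; first by rewrite !pa_mul0r.
      rewrite -!(pa_scalerAr e); congr (_ *: _).
      rewrite !pa_mul_path /path_mul; have := pcatA p q r.
      case: (pcat p q) => [x|]; case: (pcat q r) => [y|] //=;
        rewrite ?pa_mul0l ?pa_mul0r ?pa_mul_path /path_mul => //.
      + by move->.
      + by move->.
      + by move<-.
    by rewrite !pa_mulDr Hh Hh'.
  by rewrite pa_mulDl !pa_mulDr pa_mulDl Hg Hg'.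
by rewrite !pa_mulDl Hf Hf'.
Qed.

Lemma pa_mul_suml (I : Type) (s : seq I) (F : I -> kQ) g :
  pa_mul (\sum_(i <- s) F i) g = \sum_(i <- s) pa_mul (F i) g.
Proof. by apply: (big_morph (pa_mul^~ g)) => [x y|]; rewrite ?pa_mulDl ?pa_mul0l. Qed.

Lemma pa_mul_sumr (I : Type) (s : seq I) (F : I -> kQ) g :
  pa_mul g (\sum_(i <- s) F i) = \sum_(i <- s) pa_mul g (F i).
Proof. by apply: (big_morph (pa_mul g)) => [x y|]; rewrite ?pa_mulDr ?pa_mul0r. Qed.

Lemma pa_mul1 : left_id pa_one (@pa_mul k Q).
Proof.
rewrite pa_one.unlock.
elim/pa_ind=> [|c p|f f' Hf Hf']; first exact: pa_mul0r; last first.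
  by rewrite pa_mulDr Hf Hf'.
rewrite -pa_scalerAr; congr (_ *: _); rewrite pa_mul_suml (bigD1 (pstart p)) //=.
rewrite pa_mul_path /path_mul pcat_trivl eqxx /= big1 ?addr0 // => i ip.
by rewrite pa_mul_path /path_mul pcat_trivl (negbTE ip).
Qed.

Lemma pa_mulr1 : right_id pa_one (@pa_mul k Q).
Proof.
rewrite pa_one.unlock.
elim/pa_ind=> [|c p|f f' Hf Hf']; first exact: pa_mul0l; last first.
  by rewrite pa_mulDl Hf Hf'.
rewrite -pa_scalerAl; congr (_ *: _); rewrite pa_mul_sumr (bigD1 (pend p)) //=.
rewrite pa_mul_path /path_mul pcat_trivr eqxx /= big1 ?addr0 // => i ip.
by rewrite pa_mul_path /path_mul pcat_trivr eq_sym (negbTE ip).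
Qed.

End PathAlgebra.

HB.instance Definition _ (k : fieldType) (Q : quiver) :=
  GRing.Zmodule_isPzRing.Build (path_algebra k Q)
    (@pa_mulA k Q) (@pa_mul1 k Q) (@pa_mulr1 k Q) (@pa_mulDl k Q) (@pa_mulDr k Q).

Section Ideals.
Context {R : pzRingType}.
Implicit Types (I J M N : set R).

Definition right_ideal I : Prop :=
  [/\ I 0, forall x y, I x -> I y -> I (x + y)
    & forall x a, I x -> I (x * a)].

Definition two_sided_ideal I : Prop :=
  right_ideal I /\ forall a x, I x -> I (a * x).

Definition ideal_mul I J : set R :=
  [set z | exists n (x y : 'I_n -> R),
     (forall i, I (x i) /\ J (y i)) /\ z = \sum_(i < n) x i * y i].

Fixpoint ideal_pow I (n : nat) : set R :=
  if n is n'.+1 then ideal_mul I (ideal_pow I n') else setT.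

Definition maximal_right_ideal M : Prop :=
  [/\ right_ideal M, M <> setT
    & forall N, right_ideal N -> M `<=` N -> N = M \/ N = setT].

Definition jacobson_radical : set R := \bigcap_(M in maximal_right_ideal) M.

(* Least n > 0 such that x ^+ n lies in the (n + 1)-st power of the radical. *)
Definition is_radical_exponent (x : R) (n : nat) : Prop :=
  let P m := (0 < m)%N /\ ideal_pow jacobson_radical m.+1 (x ^+ m) in
  P n /\ forall m, P m -> (n <= m)%N.

End Ideals.

Arguments jacobson_radical R : clear implicits.

Section BoundQuivers.
Context {k : fieldType} {Q : quiver}.

Definition arrow_elt (a : arrow Q) : path_algebra k Q := of_path (arrow_path a).

Definition arrow_ideal : set (path_algebra k Q) :=
  smallest two_sided_ideal (range arrow_elt).

Definition admissible (I : set (path_algebra k Q)) : Prop :=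
  two_sided_ideal I /\
  exists m, [/\ (2 <= m)%N, ideal_pow arrow_ideal m `<=` I
              & I `<=` ideal_pow arrow_ideal 2].

(* A = kQ / I, with canonical projection pi. *)
Definition is_quotient_by (I : set (path_algebra k Q)) (A : falgType k)
    (pi : {rmorphism path_algebra k Q -> A}) : Prop :=
  [/\ scalable pi, range pi = setT & pi @^-1` [set 0] = I].

End BoundQuivers.

Section Derivations.
Context {k : fieldType} (A : falgType k).

Definition Der : set 'End(A) :=
  [set d : 'End(A) | forall x y, d (x * y) = d x * y + x * d y].

Definition Der_rad : set 'End(A) :=
  Der `&` [set d : 'End(A) | d @` jacobson_radical A `<=` jacobson_radical A].

Definition Inn : set 'End(A) :=
  [set d : 'End(A) | exists a, forall x, d x = a * x - x * a].

Definition Inn_coset (d : 'End(A)) : set 'End(A) := [set d + e | e in Inn].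

Definition HH1 : set (set 'End(A)) := [set Inn_coset d | d in Der].

Definition HH1_rad : set (set 'End(A)) := [set Inn_coset d | d in Der_rad].

End Derivations.

Arguments Der {k} A _.
Arguments Der_rad {k} A _.
Arguments Inn {k} A _.
Arguments HH1 {k} A _.
Arguments HH1_rad {k} A _.

Definition has_characteristic (k : fieldType) (p : nat) : Prop :=
  if p == 0%N then [pchar k] =i pred0 else p \in [pchar k].

(* Main.v *)
From HB Require Import structures.
Require Import Defs.
From mathcomp Require Import all_boot all_order all_algebra all_field.
From mathcomp Require Import boolp classical_sets.
From mathcomp.multinomials Require Import monalg.
Local Open Scope ring_scope.

Set Implicit Arguments.
Unset Strict Implicit.
Unset Printing Implicit Defensive.

Import GRing.Theory.
Local Open Scope classical_set_scope.

(** The coefficient of the trivial path at a vertex i is a character of kQ. It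
    vanishes on I, hence induces a character chi_i of A = kQ / I, and the
    common kernel of the chi_i is the Jacobson radical J of A: each kernel is a
    maximal right ideal, and conversely the common kernel is the image of the
    arrow ideal, which is nilpotent modulo I (lemma [radicalP]).

    Let d be a derivation, and e_i the image in A of the trivial path at i.
    Each chi_i \o d is a point derivation at chi_i, so d preserves J as soon as
    it maps every arrow into J ([der_radical]). If a runs from s to t, then
    a = e_s a e_t shows that chi_i (d a) = 0 unless
    i = s = t ([qcoef_der_arrow]). This settles the arrows that are not loops.
    For a loop a at i one gets d a = c e_i modulo J with c = chi_i (d a), hence
    d (a ^ n) = n c a ^ (n - 1) e_i modulo J ^ n ([der_loop_exp]). A derivation
    maps J ^ (n + 1) into J ^ n ([leibniz_ideal_pow]); so if a ^ n lies in
    J ^ (n + 1) and n c is nonzero in k, then a ^ (n - 1) e_i lies in J ^ n.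
    For n = 1 this says that e_i is in J, which is absurd, and for n > 1 it
    contradicts the minimality of n. Hence c = 0 ([der_loop_radical]). *)

(** * Powers of ideals *)

Section IdealPowers.
Context {R : pzRingType}.
Implicit Types (I J M : set R) (x y : R) (m : nat).

Lemma right_idealN I x : right_ideal I -> I x -> I (- x).
Proof. by case=> _ _ IM Ix; rewrite -mulrN1; apply: IM. Qed.

Lemma right_ideal_sum I m (F : 'I_m -> R) :
  right_ideal I -> (forall i, I (F i)) -> I (\sum_(i < m) F i).
Proof. by case=> I0 ID _ IF; apply: big_ind. Qed.

Lemma ideal_mul_mem {I J x y} : I x -> J y -> ideal_mul I J (x * y).
Proof.
by move=> Ix Jy; exists 1%N, (fun=> x), (fun=> y); rewrite big_ord1.
Qed.

Lemma ideal_mul_sub I J M : right_ideal M ->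
  (forall x y, I x -> J y -> M (x * y)) -> ideal_mul I J `<=` M.
Proof.
move=> rM IJM _ [m [x [y [IJxy ->]]]]; apply: right_ideal_sum => // i.
by have [] := IJxy i; apply: IJM.
Qed.

Lemma two_sided_ideal_mul I J :
  two_sided_ideal I -> two_sided_ideal J -> two_sided_ideal (ideal_mul I J).
Proof.
move=> [_ lI] [[_ _ rJ] _]; split; first split.
- by exists 0%N, (fun=> 0), (fun=> 0); rewrite big_ord0; split=> // -[].
- move=> _ _ [m [x [y [IJxy ->]]]] [m' [x' [y' [IJxy' ->]]]].
  exists (m + m')%N.
  exists (fun i => match split i with inl j => x j | inr j => x' j end).
  exists (fun i => match split i with inl j => y j | inr j => y' j end).
  split; first by move=> i; case: (split i).
  rewrite big_split_ord /=; congr (_ + _); apply: eq_bigr => i _.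
    by rewrite -[lshift _ i]/(unsplit (inl i)) unsplitK.
  by rewrite -[rshift _ i]/(unsplit (inr i)) unsplitK.
- move=> _ b [m [x [y [IJxy ->]]]]; exists m, x, (fun i => y i * b).
  split; first by move=> i; have [? ?] := IJxy i; split; last exact: rJ.
  by rewrite mulr_suml; apply: eq_bigr => i _; rewrite mulrA.
- move=> b _ [m [x [y [IJxy ->]]]]; exists m, (fun i => b * x i), y.
  split; first by move=> i; have [? ?] := IJxy i; split; first exact: lI.
  by rewrite mulr_sumr; apply: eq_bigr => i _; rewrite mulrA.
Qed.

Lemma two_sided_ideal_pow I m :
  two_sided_ideal I -> two_sided_ideal (ideal_pow I m).
Proof.
by move=> tI; elim: m => [|m IHm] /=; [|apply: two_sided_ideal_mul].
Qed.

Lemma ideal_pow_exp I x m : I x -> ideal_pow I m (x ^+ m).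
Proof.
by move=> Ix; elim: m => [|m IHm] //; rewrite exprS; apply: ideal_mul_mem.
Qed.

Lemma ideal_pow1_sub I : two_sided_ideal I -> ideal_pow I 1 `<=` I.
Proof.
by move=> [rI lI]; apply: ideal_mul_sub => // x y Ix _; case: rI => _ _; apply.
Qed.

(** Any additive map obeying the Leibniz rule lowers the adic order by at
    most one. *)
Lemma leibniz_ideal_pow I (d : {additive R -> R}) m :
  two_sided_ideal I -> (forall x y, d (x * y) = d x * y + x * d y) ->
  forall x, ideal_pow I m.+1 x -> ideal_pow I m (d x).
Proof.
move=> tI dM; elim: m => [|m IHm] // _ [n [x [y [IJxy ->]]]].
have [rIm lIm] := two_sided_ideal_pow m.+1 tI.
rewrite raddf_sum; apply: right_ideal_sum => // i.
have [Ix Iy] := IJxy i; rewrite dM; case: rIm => _ IDm _; apply: IDm.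
  exact: lIm.
by apply: ideal_mul_mem => //; apply: IHm.
Qed.

(** * Maximal right ideals and nilpotent elements *)

Lemma maximal_right_ideal_ker (F : fieldType) (chi : {rmorphism R -> F}) :
  (forall c, exists x, chi x = c) -> maximal_right_ideal (chi @^-1` [set 0]).
Proof.
move=> chi_onto; split.
- split=> [|x y|x a] /=; first by rewrite rmorph0.
    by rewrite rmorphD => -> ->; rewrite addr0.
  by rewrite rmorphM => ->; rewrite mul0r.
- move=> kerT; have: (chi @^-1` [set 0]) 1 by rewrite kerT.
  by move=> /= /eqP; rewrite rmorph1 oner_eq0.
move=> N rN kerN; have [Nker|] := pselect (N `<=` chi @^-1` [set 0]).
  by left; apply/seteqP.
move=> /existsNP[x /not_implyP[Nx /eqP chix]]; right.
have [_ ND NM] := rN; have [z chiz] := chi_onto (chi x)^-1.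
have N1 : N 1.
  rewrite -[1](subrK (x * z)); apply: ND; last exact: NM.
  by apply: kerN => /=; rewrite rmorphB rmorphM rmorph1 chiz mulfV ?subrr.
by apply/seteqP; split=> // y _; rewrite -[y]mul1r; apply: NM.
Qed.

Lemma nil_right_ideal_sub_jacobson I : right_ideal I ->
  (forall x, I x -> exists m, x ^+ m = 0) -> I `<=` jacobson_radical R.
Proof.
move=> [I0 ID IM] nilI x Ix M [rM M_neqT maxM]; apply: contrapT => nMx.
have [M0 MD MM] := rM.
pose N : set R := [set z | exists2 y, M y & exists b, z = y + x * b].
have rN : right_ideal N.
  split; first by exists 0 => //; exists 0; rewrite mulr0 addr0.
    move=> _ _ [y My [b ->]] [y' My' [b' ->]].
    by exists (y + y'); [exact: MD | exists (b + b'); rewrite mulrDr addrACA].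
  move=> _ c [y My [b ->]]; exists (y * c); first exact: MM.
  by exists (b * c); rewrite mulrDl mulrA.
have MN : M `<=` N by move=> y My; exists y => //; exists 0; rewrite mulr0 addr0.
have Nx : N x by exists 0 => //; exists 1; rewrite mulr1 add0r.
have [NM|NT] := maxM N rN MN; first by rewrite -NM in nMx.
have [y My [b y_eq]] : N 1 by rewrite NT.
have [m xbm] := nilI _ (IM x b Ix).
have M1 : M 1.
  (* 1 - x b lies in M and is invertible by the geometric series. *)
  have -> : 1 = y * \sum_(i < m) (x * b) ^+ i.
    have -> : y = 1 - x * b by rewrite y_eq addrK.
    by rewrite -opprB mulNr -subrX1 xbm sub0r opprK.
  exact: MM.
by apply: M_neqT; apply/seteqP; split=> // z _; rewrite -[z]mul1r; apply: MM.
Qed.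

End IdealPowers.

(** * The path algebra and its trivial-path coefficients *)

Section PathAlgebra.
Context {k : fieldType} {Q : quiver}.
Local Notation kQ := (path_algebra k Q).
Implicit Types (f g : kQ) (p q : qpath Q) (i j : vertex Q).

Definition vertex_elt i : kQ := of_path (trivial_path i).

(** The coefficient of the trivial path at [i]: a character of the path
    algebra. *)
Definition vcoef i f : k := f@_(trivial_path i).

Lemma vcoef_is_zmod_morphism i : zmod_morphism (vcoef i).
Proof. by move=> f g; rewrite /vcoef mcoeffB. Qed.

HB.instance Definition _ i :=
  GRing.isZmodMorphism.Build kQ k (vcoef i) (vcoef_is_zmod_morphism i).

Lemma vcoefZ i (c : k) f : vcoef i (c *: f) = c * vcoef i f.
Proof. exact: mcoeffZ. Qed.

Lemma vcoef_path i p : vcoef i (of_path p) = (p == trivial_path i)%:R.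
Proof. by rewrite /vcoef of_path.unlock mcoeffU. Qed.

Lemma vcoef_vertex i j : vcoef i (vertex_elt j) = (j == i)%:R.
Proof.
rewrite vcoef_path; congr (_%:R); congr nat_of_bool.
by apply/eqP/eqP => [/(congr1 pstart)|->].
Qed.

Lemma vcoef_arrow i (a : arrow Q) : vcoef i (arrow_elt a) = 0.
Proof.
by rewrite vcoef_path; case: eqP => // /(congr1 parrows).
Qed.

Lemma vcoef_path_mul i p q :
  vcoef i (path_mul p q) = vcoef i (of_path p) * vcoef i (of_path q).
Proof.
rewrite /path_mul !vcoef_path; have [->|p_neq] := eqVneq p (trivial_path i).
  rewrite pcat_trivl mul1r; have [->|iq] := eqVneq i (pstart q).
    by rewrite /= vcoef_path.
  case: eqP => [q_eq|_]; last by rewrite /= raddf0.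
  by rewrite q_eq eqxx in iq.
rewrite mul0r; have [pq|pq] := eqVneq (pend p) (pstart q); last first.
  by rewrite pcat_none //= raddf0.
have [r [-> sr _ ar]] := pcat_some pq; rewrite /= vcoef_path.
case: eqP => // r_eq; case/eqP: p_neq; apply: qpath_eq; first by rewrite -sr r_eq.
by move: ar; rewrite r_eq; case: (parrows p).
Qed.

Lemma vcoef_is_monoid_morphism i : monoid_morphism (vcoef i).
Proof.
split.
  have -> : 1 = \sum_j vertex_elt j :> kQ
    by rewrite -[LHS]/(pa_one) pa_one.unlock.
  rewrite raddf_sum (bigD1 i) //= vcoef_vertex eqxx big1 ?addr0 // => j ji.
  by rewrite vcoef_vertex (negbTE ji).
move=> f g; elim/(@pa_ind k Q): f => [|c p|f f' Hf Hf'].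
- by rewrite mul0r raddf0 mul0r.
- elim/(@pa_ind k Q): g => [|d q|g g' Hg Hg'].
  + by rewrite mulr0 raddf0 mulr0.
  + rewrite -[_ * _]/(pa_mul _ _) -pa_scalerAl -pa_scalerAr pa_mul_path.
    rewrite [LHS]vcoefZ [X in _ * X = _]vcoefZ [X in _ = X * _]vcoefZ.
    by rewrite [X in _ = _ * X]vcoefZ vcoef_path_mul [RHS]mulrACA mulrA.
  + by rewrite mulrDr !raddfD /= Hg Hg' mulrDr.
- by rewrite mulrDl !raddfD /= Hf Hf' mulrDl.
Qed.

HB.instance Definition _ i :=
  GRing.isMonoidMorphism.Build kQ k (vcoef i) (vcoef_is_monoid_morphism i).

Lemma right_idealZ (J : set kQ) (c : k) f : right_ideal J -> J f -> J (c *: f).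
Proof.
case=> _ _ JM Jf; rewrite -[f]mulr1 -[_ * _]/(pa_mul _ _) pa_scalerAr.
exact: JM.
Qed.

Lemma two_sided_arrow_ideal : two_sided_ideal (@arrow_ideal k Q).
Proof.
split; first split.
- by move=> J [[[]]].
- move=> f g Jf Jg J JP; have [[[_ JD _] _] _] := JP.
  by apply: JD; [apply: Jf | apply: Jg].
- by move=> f g Jf J JP; have [[[_ _ JM] _] _] := JP; apply: JM; apply: Jf.
- by move=> g f Jf J JP; have [[_ lJ] _] := JP; apply: lJ; apply: Jf.
Qed.

Lemma arrow_ideal_arrow (a : arrow Q) : @arrow_ideal k Q (arrow_elt a).
Proof. by move=> J [_]; apply; exists a. Qed.

Lemma arrow_ideal_path p : parrows p <> [::] -> @arrow_ideal k Q (of_path p).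
Proof.
case: p => -[i [|a s]] // w _; have /andP[/eqP sa ws] := w.
pose q := @QPath Q (target a, s) ws.
have -> : of_path (QPath w) = arrow_elt a * of_path q :> kQ.
  rewrite -[_ * _]/(pa_mul _ _) pa_mul_path /path_mul.
  have [|r [-> sr _ ar]] := @pcat_some Q (arrow_path a) q; first by [].
  by congr of_path; apply: qpath_eq; rewrite ?sr ?ar.
by have [[_ _ JM] _] := two_sided_arrow_ideal;
  apply: JM; apply: arrow_ideal_arrow.
Qed.

(** The arrow ideal is spanned by the nontrivial paths, that is, it is the
    common kernel of the characters [vcoef i]. *)
Lemma arrow_idealP f : (@arrow_ideal k Q) f <-> forall i, vcoef i f = 0.
Proof.
split=> [Jf i|f0].
  apply: (Jf (vcoef i @^-1` [set 0])); split; last first.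
    by move=> _ [a _ <-]; apply: vcoef_arrow.
  split; first split.
  - exact: rmorph0.
  - by move=> g h /= g0 h0; rewrite rmorphD /= g0 h0 addr0.
  - by move=> g h /= g0; rewrite rmorphM /= g0 mul0r.
  - by move=> h g /= g0; rewrite rmorphM /= g0 mulr0.
have [rJ _] := two_sided_arrow_ideal; have [J0 JD _] := rJ.
suff: arrow_ideal (f - \sum_i vcoef i f *: vertex_elt i).
  by rewrite big1 ?subr0 // => i _; rewrite f0 scale0r.
elim/(@pa_ind k Q): f {f0} => [|c p|f g Hf Hg].
- by rewrite big1 ?subr0 // => i _; rewrite raddf0 scale0r.
- have [p0|/eqP p0] := eqVneq (parrows p) [::]; last first.
    rewrite big1 ?subr0 => [|i _].
      exact: (right_idealZ c rJ (arrow_ideal_path p0)).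
    rewrite vcoefZ vcoef_path; case: eqP => [pi|_]; first by rewrite pi in p0.
    by rewrite mulr0 scale0r.
  have -> : p = trivial_path (pstart p) by apply: qpath_eq.
  rewrite (bigD1 (pstart p)) //= vcoefZ vcoef_vertex eqxx mulr1 big1.
    by rewrite addr0 subrr.
  by move=> i ip; rewrite vcoefZ vcoef_vertex eq_sym (negbTE ip) mulr0 scale0r.
- under eq_bigr do rewrite raddfD scalerDl.
  have addBACA (u v u' v' : kQ) : u + v - (u' + v') = (u - u') + (v - v').
    by rewrite opprD addrACA.
  by rewrite big_split addBACA; exact: (JD _ _ Hf Hg).
Qed.

Lemma vertex_arrow (a : arrow Q) :
  vertex_elt (source a) * arrow_elt a = arrow_elt a.
Proof.
by rewrite -[_ * _]/(pa_mul _ _) pa_mul_path /path_mul pcat_trivl eqxx.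
Qed.

Lemma arrow_vertex (a : arrow Q) :
  arrow_elt a * vertex_elt (target a) = arrow_elt a.
Proof.
by rewrite -[_ * _]/(pa_mul _ _) pa_mul_path /path_mul pcat_trivr eqxx.
Qed.

End PathAlgebra.

(** * The radical of a bound quiver algebra *)

Section BoundQuiverAlgebra.
Context {k : fieldType} {Q : quiver} {I : set (path_algebra k Q)}.
Context {A : falgType k} { pi : {rmorphism path_algebra k Q -> A} }.
Context (admI : admissible I) (quoA : is_quotient_by I pi).
Local Notation kQ := (path_algebra k Q).
Local Notation J := (jacobson_radical A).
Implicit Types (f g : kQ) (x y : A) (i j : vertex Q).

Let pi_onto x : exists f, pi f = x.
Proof.
have [_ piT _] := quoA; have [f _ <-] : range pi x by rewrite piT.
by exists f.
Qed.

Let lift x : kQ := projT1 (cid (pi_onto x)).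

Let liftK x : pi (lift x) = x.
Proof. by rewrite /lift; case: cid. Qed.

Lemma admissible_sub_arrow_ideal : I `<=` arrow_ideal.
Proof.
have [_ [m [_ _ I2]]] := admI; apply: (subset_trans I2).
have [rJ lJ] := @two_sided_arrow_ideal k Q.
by apply: ideal_mul_sub => // f g Jf _; case: rJ => _ _; apply.
Qed.

(** The character of the quotient induced by [vcoef i], read on an arbitrary
    lift. *)
Definition qcoef i x : k := vcoef i (lift x).

Lemma qcoef_pi i f : qcoef i (pi f) = vcoef i f.
Proof.
apply/eqP; rewrite -subr_eq0 /qcoef -raddfB; apply/eqP.
have [_ _ kerI] := quoA.
apply: (proj1 (arrow_idealP _)); apply: admissible_sub_arrow_ideal.
by rewrite -kerI /= rmorphB liftK subrr.
Qed.

Lemma qcoef_is_zmod_morphism i : zmod_morphism (qcoef i).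
Proof.
by move=> x y; rewrite -(liftK x) -(liftK y) -rmorphB !qcoef_pi raddfB.
Qed.

HB.instance Definition _ i :=
  GRing.isZmodMorphism.Build A k (qcoef i) (qcoef_is_zmod_morphism i).

Lemma qcoef_is_monoid_morphism i : monoid_morphism (qcoef i).
Proof.
split=> [|x y]; first by rewrite -(rmorph1 pi) qcoef_pi rmorph1.
by rewrite -(liftK x) -(liftK y) -rmorphM !qcoef_pi rmorphM.
Qed.

HB.instance Definition _ i :=
  GRing.isMonoidMorphism.Build A k (qcoef i) (qcoef_is_monoid_morphism i).

Lemma qcoefZ i (c : k) x : qcoef i (c *: x) = c * qcoef i x.
Proof.
have [piZ _ _] := quoA.
by rewrite -(liftK x) -piZ !qcoef_pi vcoefZ.
Qed.

Lemma qcoef0_lift x : (forall i, qcoef i x = 0) ->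
  exists2 f, arrow_ideal f & pi f = x.
Proof.
move=> x0; exists (lift x); last exact: liftK.
by apply/arrow_idealP => i; rewrite -qcoef_pi liftK.
Qed.

(** The Jacobson radical is the image of the arrow ideal: the kernel of each
    character is a maximal right ideal, and the arrow ideal is nilpotent
    modulo [I]. *)
Lemma radicalP x : J x <-> forall i, qcoef i x = 0.
Proof.
split=> [Jx i|].
  apply: (Jx (qcoef i @^-1` [set 0])); apply: maximal_right_ideal_ker => c.
  by exists (c *: 1); rewrite /= qcoefZ rmorph1 mulr1.
move: x; apply: nil_right_ideal_sub_jacobson.
  split=> [i|x y x0 y0 i|x y x0 i]; first by rewrite rmorph0.
    by rewrite rmorphD /= x0 y0 addr0.
  by rewrite rmorphM /= x0 mul0r.
move=> x /qcoef0_lift[f Jf <-]; have [_ [m [_ JmI _]]] := admI.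
have [_ _ kerI] := quoA; exists m; rewrite -rmorphXn.
have: I (f ^+ m) by apply/JmI/ideal_pow_exp.
by rewrite -kerI.
Qed.

Lemma two_sided_radical : two_sided_ideal J.
Proof.
split; first split.
- by apply/radicalP => i; rewrite rmorph0.
- move=> x y /radicalP x0 /radicalP y0; apply/radicalP => i.
  by rewrite rmorphD /= x0 y0 addr0.
- by move=> x y /radicalP x0; apply/radicalP => i; rewrite rmorphM /= x0 mul0r.
- by move=> y x /radicalP x0; apply/radicalP => i; rewrite rmorphM /= x0 mulr0.
Qed.

Lemma radical_arrow (a : arrow Q) : J (pi (arrow_elt a)).
Proof. by apply/radicalP => i; rewrite qcoef_pi vcoef_arrow. Qed.

(** * Derivations *)

Section Derivation.
Context (d : 'End(A)) (derd : Der A d).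
Local Notation e i := (pi (vertex_elt i)).

Lemma qcoef_der i x y :
  qcoef i (d (x * y)) = qcoef i (d x) * qcoef i y + qcoef i x * qcoef i (d y).
Proof. by rewrite derd rmorphD !rmorphM. Qed.

(** The constant term at [i] of the derivative of an arrow vanishes unless
    the arrow is a loop at [i]. *)
Lemma qcoef_der_arrow i (a : arrow Q) :
  ~~ ((source a == i) && (target a == i)) -> qcoef i (d (pi (arrow_elt a))) = 0.
Proof.
rewrite negb_and => /orP[/negbTE s|/negbTE t].
- rewrite -vertex_arrow rmorphM qcoef_der !qcoef_pi vcoef_vertex s.
  by rewrite vcoef_arrow mulr0 mul0r addr0.
- rewrite -arrow_vertex rmorphM qcoef_der !qcoef_pi vcoef_vertex t.
  by rewrite vcoef_arrow mulr0 mul0r addr0.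
Qed.

(** A derivation stabilises the radical as soon as it sends every arrow into
    it: the composites of [d] with the characters are point derivations, so
    they kill the ideal generated by the arrows when they kill the arrows. *)
Lemma der_radical : (forall a : arrow Q, J (d (pi (arrow_elt a)))) ->
  forall x, J x -> J (d x).
Proof.
move=> Jd x /radicalP/qcoef0_lift[f Jf <-]; apply/radicalP => i.
pose K := [set f | qcoef i (pi f) = 0 /\ qcoef i (d (pi f)) = 0].
suff: K f by case.
apply: Jf; split; last first.
  move=> _ [a _ <-]; split; first by rewrite qcoef_pi vcoef_arrow.
  exact: (proj1 (radicalP _) (Jd a)).
split; first split.
- by split=> /=; rewrite !raddf0.
- move=> g h [g0 dg0] [h0 dh0].
  by split; rewrite !raddfD /= ?g0 ?dg0 ?h0 ?dh0 addr0.
- move=> g h [g0 dg0].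
  by split; rewrite rmorphM ?qcoef_der ?rmorphM /= ?g0 ?dg0 ?mul0r ?addr0.
- move=> h g [g0 dg0].
  by split; rewrite rmorphM ?qcoef_der ?rmorphM /= ?g0 ?dg0 ?mulr0 ?addr0.
Qed.

Section Loop.
Context (a : arrow Q) (loop_a : is_loop a).
Local Notation i := (source a).
Local Notation x := (pi (arrow_elt a)).
Local Notation c := (qcoef i (d x)).

Let vx : e i * x = x.
Proof. by rewrite -rmorphM vertex_arrow. Qed.

Let xv : x * e i = x.
Proof. by rewrite -rmorphM (eqP loop_a) arrow_vertex. Qed.

Lemma der_loop_const : J (d x - c *: e i).
Proof.
apply/radicalP => j; rewrite rmorphB /= qcoefZ qcoef_pi vcoef_vertex.
have [<-|ij] := eqVneq i j; first by rewrite mulr1 subrr.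
by rewrite qcoef_der_arrow ?(negbTE ij) // mulr0 subr0.
Qed.

Lemma der_loop_exp m :
  ideal_pow J m.+1 (d (x ^+ m.+1) - (m.+1%:R * c) *: (x ^+ m * e i)).
Proof.
have Jx := radical_arrow a; have Jr := der_loop_const.
elim: m => [|m IHm].
  rewrite expr1 expr0 mul1r mul1r -[X in ideal_pow _ _ X]mulr1.
  exact: ideal_mul_mem.
have [[_ JD _] _] := two_sided_ideal_pow m.+2 two_sided_radical.
have xmv : x ^+ m.+1 * e i = x ^+ m.+1 by rewrite exprSr -mulrA xv.
have vxm : e i * x ^+ m.+1 = x ^+ m.+1 by rewrite exprS mulrA vx.
have -> : d (x ^+ m.+2) - (m.+2%:R * c) *: (x ^+ m.+1 * e i) =
    (d x - c *: e i) * x ^+ m.+1 +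
    x * (d (x ^+ m.+1) - (m.+1%:R * c) *: (x ^+ m * e i)).
  rewrite [x ^+ m.+2]exprS derd mulrBl mulrBr -scalerAl vxm -scalerAr mulrA.
  rewrite -exprS xmv [RHS]addrACA -opprD -scalerDl.
  by rewrite mulrS mulrDl mul1r.
apply: JD; first exact: (ideal_mul_mem Jr (ideal_pow_exp m.+1 Jx)).
exact: (ideal_mul_mem Jx IHm).
Qed.

(** If the radical exponent [m] of the loop is invertible in the field, then
    applying [d] to the relation of order [m] and dividing by [m] would lower
    the exponent, unless the constant term of the derivative is zero. *)
Lemma der_loop_radical m : is_radical_exponent x m -> m%:R != 0 :> k -> J (d x).
Proof.
move=> [[m_gt0 xm] min_m] m_neq0; have tJ := two_sided_radical.
have [c0|c_neq0] := eqVneq c 0.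
  by have := der_loop_const; rewrite c0 scale0r subr0.
case: m m_gt0 xm min_m m_neq0 => // m _ xm min_m m_neq0; exfalso.
have [rJm _] := two_sided_ideal_pow m.+1 tJ; have [_ JD JM] := rJm.
have Jxm : ideal_pow J m.+1 (x ^+ m * e i).
  have mc : m.+1%:R * c != 0 by rewrite mulf_neq0.
  rewrite -[_ * _](scalerK mc) -[_ *: (_ *: _)]mulr1 -scalerAl scalerAr.
  apply: JM; rewrite -[X in ideal_pow _ _ X](subKr (d (x ^+ m.+1))).
  apply: JD; first exact: leibniz_ideal_pow xm.
  by apply: right_idealN => //; apply: der_loop_exp.
case: m Jxm {xm m_neq0 rJm JD JM} min_m => [|m] Jxm min_m.
  move: (ideal_pow1_sub tJ Jxm) => /radicalP/(_ i)/eqP.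
  by rewrite expr0 mul1r qcoef_pi vcoef_vertex eqxx oner_eq0.
move: Jxm; rewrite exprSr -mulrA xv -exprSr => Jxm.
by have := min_m m.+1 (conj isT Jxm); rewrite ltnn.
Qed.

End Loop.
End Derivation.
End BoundQuiverAlgebra.

Lemma natr_neq0_of_ndvd (k : fieldType) (p m : nat) :
  has_characteristic k p -> ~~ (p %| m)%N -> m%:R != 0 :> k.
Proof.
rewrite /has_characteristic; case: eqP => [->|_] chark.
  by rewrite dvd0n (proj1 (pcharf0P k) chark).
by rewrite (dvdn_pcharf chark).
Qed.

Theorem proposition2p7 (k : fieldType) (p : nat) (Q : quiver)
    (I : set (path_algebra k Q)) (A : falgType k)
    (pi : {rmorphism path_algebra k Q -> A}) (n : arrow Q -> nat) :
  has_characteristic k p ->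
  admissible I ->
  is_quotient_by I pi ->
  (forall a : arrow Q, is_loop a -> is_radical_exponent (pi (arrow_elt a)) (n a)) ->
  ~~ (p %| \prod_(a : arrow Q | is_loop a) n a)%N ->
  Der_rad A = Der A /\ HH1_rad A = HH1 A.
Proof.
move=> chark admI quoA n_exp p_ndvd.
suff DerE : Der_rad A = Der A by rewrite /HH1_rad DerE.
apply/seteqP; split=> [d []//|d derd]; split=> // _ [x Jx <-].
apply: (der_radical admI quoA derd _ Jx) => a.
have [loop_a|nloop_a] := boolP (is_loop a).
  apply: (der_loop_radical admI quoA derd loop_a (n_exp a loop_a)).
  apply: natr_neq0_of_ndvd chark _; apply: contra p_ndvd => p_na.
  by rewrite (bigD1 a) //= dvdn_mulr.
apply/(radicalP admI quoA) => i; apply: qcoef_der_arrow => //.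
by apply: contra nloop_a => /andP[/eqP si /eqP ti]; rewrite /is_loop si ti.
Qed.
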